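(* Let $H$ be a finite index set, let $D=(D_{ij})_{i,j\in H}$ and $G=(G_{ij})_{i,j\in H}$ be complex matrices with $\det D\neq0$, and let $(Q_i(w))_{i\in H}$ be the unique family of power series in $\mathbb{C}[[w]]$, $w=(w_i)_{i\in H}$, with constant terms $1$ satisfying $$\prod_{j\in H}(Q_j(w))^{D_{ij}}+w_i\prod_{j\in H}(Q_j(w))^{G_{ij}}=1\qquad (i\in H).$$ For $\nu=(\nu_i)_{i\in H}\in\mathbb{C}^H$ let $Q^\nu_{D,G}(w):=\prod_{i\in H}(Q_i(w))^{\nu_i}$. Then $$Q^\nu_{D,G}(w)=K^\nu_{D,G}(w)/K^0_{D,G}(w),\qquad Q^\nu_{D,G}(w)=R^\nu_{D,G}(w),$$ where $K^\nu_{D,G}$ and $R^\nu_{D,G}$ are the power series defined in the context.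
   Context: For a power series $f(w)$ with constant term $1$ and $\alpha\in\mathbb{C}$, $(f(w))^\alpha$ denotes the $\alpha$-th power of $f$ with constant term $1$. For $a\in\mathbb{C}$, $b\in\mathbb{Z}_{\ge0}$, $\binom{a}{b}=\frac{\Gamma(a+1)}{\Gamma(a-b+1)\Gamma(b+1)}$, with the limit value at singularities (so $\binom ab=a(a-1)\cdots(a-b+1)/b!$). Let $\mathcal{N}=(\mathbb{Z}_{\ge0})^H$; for $N\in\mathcal N$ let $w^N=\prod_{i\in H}w_i^{N_i}$ and $H(N)=\{i\in H\mid N_i\neq0\}$. For $\nu\in\mathbb{C}^H$ and $N\in\mathcal N$ put $$P_i=P_i(D,G;\nu,N)=-\sum_{j\in H}\nu_j(D^{-1})_{ji}-\sum_{j\in H}N_j(GD^{-1})_{ji},\qquad F_{ij}=\delta_{ij}P_j+(GD^{-1})_{ij}N_j,$$ $$K^\nu_{D,G}(w)=\sum_{N\in\mathcal N}\Bigl(\prod_{i\in H(N)}\binom{P_i+N_i}{N_i}\Bigr)w^N,$$ $$R^\nu_{D,G}(w)=\sum_{N\in\mathcal N}\Bigl(\det_{i,j\in H(N)}F_{ij}\Bigr)\Bigl(\prod_{i\in H(N)}\frac1{N_i}\binom{P_i+N_i-1}{N_i-1}\Bigr)w^N,$$ where empty determinants and empty products are $1$. *)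

(* Defs.v *)
From HB Require Import structures.
From mathcomp Require Import all_boot all_order all_algebra.
From mathcomp Require Import boolp reals complex mpoly.
Set Implicit Arguments.
Unset Strict Implicit.
Unset Printing Implicit Defensive.
Import GRing.Theory.
Local Open Scope ring_scope.

(* The ring K[[w_1, ..., w_n]].  A series is the family of its coefficients,
   indexed by the monomials 'X_{1..n} of the multinomials library. *)
Record mfps (K : fieldType) (n : nat) := MFPS { mfcoef :> 'X_{1..n} -> K }.

Section PowerSeriesRing.
Variables (K : fieldType) (n : nat).
Implicit Types f g h : mfps K n.
Implicit Types N : 'X_{1..n}.

Lemma mfpsP f g : (forall N, f N = g N) -> f = g.
Proof. by case: f g => [f] [g] /= /funext ->. Qed.

HB.instance Definition _ := gen_eqMixin (mfps K n).
HB.instance Definition _ := gen_choiceMixin (mfps K n).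

Definition mfps_add f g : mfps K n := MFPS (fun N => f N + g N).
Definition mfps_opp f : mfps K n := MFPS (fun N => - f N).
Definition mfpsC (c : K) : mfps K n := MFPS (fun N => c * (N == 0%MM)%:R).
Definition mfpsX (i : 'I_n) : mfps K n := MFPS (fun N => (N == U_(i)%MM)%:R).
Definition mfps_mul f g : mfps K n := MFPS (fun N =>
  \sum_(k : 'X_{1..n < (mdeg N).+1, (mdeg N).+1} | N == (k.1 + k.2)%MM)
     f k.1 * g k.2).

Fact mfps_addA : associative mfps_add.
Proof. by move=> f g h; apply: mfpsP => N /=; rewrite addrA. Qed.
Fact mfps_addC : commutative mfps_add.
Proof. by move=> f g; apply: mfpsP => N /=; rewrite addrC. Qed.
Fact mfps_add0 : left_id (mfpsC 0) mfps_add.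
Proof. by move=> f; apply: mfpsP => N /=; rewrite mul0r add0r. Qed.
Fact mfps_addN : left_inverse (mfpsC 0) mfps_opp mfps_add.
Proof. by move=> f; apply: mfpsP => N /=; rewrite mul0r addNr. Qed.

HB.instance Definition _ := GRing.isZmodule.Build (mfps K n)
  mfps_addA mfps_addC mfps_add0 mfps_addN.

Definition mftrunc d f : {mpoly K[n]} := \sum_(m : 'X_{1..n < d}) f m *: 'X_[m].

Lemma mftruncE d f N : (mdeg N < d)%N -> (mftrunc d f)@_N = f N.
Proof. by move=> ltN; rewrite mcoeff_mpoly. Qed.

Lemma bm_lt N (k : 'X_{1..n < (mdeg N).+1}) d :
  (mdeg N < d)%N -> (mdeg k < d)%N.
Proof. by apply: leq_trans; apply: bmdeg. Qed.

Lemma mfps_mulE d f g N : (mdeg N < d)%N ->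
  mfps_mul f g N = (mftrunc d f * mftrunc d g)@_N.
Proof.
move=> ltN; rewrite mcoeffM /=; apply: eq_bigr => k _.
by rewrite !mftruncE //; apply: bm_lt ltN.
Qed.

Lemma mfps_mul_trunc d f g (p q : {mpoly K[n]}) N : (mdeg N < d)%N ->
  (forall M, (mdeg M < d)%N -> f M = p@_M) ->
  (forall M, (mdeg M < d)%N -> g M = q@_M) -> mfps_mul f g N = (p * q)@_N.
Proof.
move=> ltN fp gq; rewrite mcoeffM /=; apply: eq_bigr => k _.
by rewrite fp ?gq //; apply: bm_lt ltN.
Qed.

Fact mfps_mulA : associative mfps_mul.
Proof.
move=> f g h; apply: mfpsP => N; pose d := (mdeg N).+1.
rewrite (@mfps_mul_trunc d _ _ (mftrunc d f) (mftrunc d g * mftrunc d h)) //.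
- rewrite mulrA; symmetry; apply: (@mfps_mul_trunc d) => // M ltM.
    exact: mfps_mulE.
  by rewrite mftruncE.
- by move=> M ltM; rewrite mftruncE.
by move=> M ltM; apply: mfps_mulE.
Qed.

Fact mfps_mulC : commutative mfps_mul.
Proof.
move=> f g; apply: mfpsP => N.
by rewrite !(@mfps_mulE (mdeg N).+1) // mulrC.
Qed.

Fact mfps_mul1 : left_id (mfpsC 1) mfps_mul.
Proof.
move=> f; apply: mfpsP => N; pose d := (mdeg N).+1.
rewrite (@mfps_mul_trunc d _ _ 1 (mftrunc d f)) //.
- by rewrite mul1r mftruncE.
- by move=> M _; rewrite mcoeff1 /= mul1r.
by move=> M ltM; rewrite mftruncE.
Qed.

Fact mfps_mulDl : left_distributive mfps_mul mfps_add.
Proof.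
move=> f g h; apply: mfpsP => N /=; rewrite -big_split /=.
by apply: eq_bigr => k _; rewrite mulrDl.
Qed.

Fact mfps_oner_neq0 : mfpsC 1 != 0.
Proof.
apply/eqP => /(congr1 (fun f : mfps K n => f 0%MM)) /= /eqP.
by rewrite eqxx mulr1 mul0r oner_eq0.
Qed.

HB.instance Definition _ := GRing.Zmodule_isComNzRing.Build (mfps K n)
  mfps_mulA mfps_mulC mfps_mul1 mfps_mulDl mfps_oner_neq0.

Lemma mfcoefD f g N : (f + g) N = f N + g N. Proof. by []. Qed.
Lemma mfcoefN f N : (- f) N = - f N. Proof. by []. Qed.
Lemma mfcoefB f g N : (f - g) N = f N - g N. Proof. by []. Qed.
Lemma mfcoef0 N : (0 : mfps K n) N = 0. Proof. exact: mul0r. Qed.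
Lemma mfcoef1 N : (1 : mfps K n) N = (N == 0%MM)%:R. Proof. exact: mul1r. Qed.
Lemma mfcoefM f g N : (f * g) N =
  \sum_(k : 'X_{1..n < (mdeg N).+1, (mdeg N).+1} | N == (k.1 + k.2)%MM)
     f k.1 * g k.2.
Proof. by []. Qed.

Lemma mfcoefM0 f g : (f * g) 0%MM = f 0%MM * g 0%MM.
Proof.
rewrite mfcoefM (bigD1 (bm0, bm0)) /=; last by rewrite addm0.
rewrite big1 ?addr0 // => -[k1 k2] /= /andP[/eqP/esym/eqP].
by rewrite mnmD_eq0 => /andP[/eqP e1 /eqP e2]; rewrite xpair_eqE !bmeqP e1 e2 eqxx.
Qed.

Lemma mfcoef_exp_gt f k N : f 0%MM = 0 -> (mdeg N < k)%N -> (f ^+ k) N = 0.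
Proof.
move=> f0; elim: k N => [|k IHk] N //; rewrite ltnS exprS mfcoefM => leN.
rewrite big1 // => -[k1 k2] /= /eqP eN.
have [->|k1_neq0] := eqVneq (k1 : 'X_{1..n}) 0%MM; first by rewrite f0 mul0r.
rewrite IHk ?mulr0 //; apply: leq_trans leN.
suff: (mdeg k2 < mdeg k1 + mdeg k2)%N by rewrite -mdegD -eN.
by rewrite -[X in (X < _)%N]add0n ltn_add2r lt0n mdeg_eq0.
Qed.

(* The series \sum_k a_k f^k, for f without constant term: then f^k has no
   monomial of degree less than k, so each coefficient is a finite sum. *)
Definition mfps_subst (a : nat -> K) f : mfps K n :=
  MFPS (fun N => \sum_(k < (mdeg N).+1) a k * (f ^+ k) N).

Lemma mfps_substE a f d N : f 0%MM = 0 -> (mdeg N < d)%N ->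
  mfps_subst a f N = \sum_(k < d) a k * (f ^+ k) N.
Proof.
move=> f0 ltN /=; rewrite (big_ord_widen _ (fun k => a k * (f ^+ k) N) ltN).
rewrite big_mkcond /=; apply: eq_bigr => k _; case: ifPn => //.
by rewrite -leqNgt => leN; rewrite mfcoef_exp_gt ?mulr0.
Qed.

Definition mfps_unit f := f 0%MM != 0.

(* f^-1 = c * \sum_k (1 - c f)^k where c is the inverse of the constant term
   of f. *)
Definition mfps_inv f : mfps K n :=
  if mfps_unit f then
    let c := mfpsC (f 0%MM)^-1 in c * mfps_subst (fun=> 1) (1 - c * f)
  else f.

Lemma mfcoef_sum I (r : seq I) (F : I -> mfps K n) N :
  (\sum_(i <- r) F i) N = \sum_(i <- r) F i N.
Proof.
by elim/big_rec2: _ => [|i x y _ <-]; rewrite ?mfcoef0.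
Qed.

Lemma mfps_geometric f : f 0%MM = 0 ->
  (1 - f) * mfps_subst (fun=> 1) f = 1.
Proof.
move=> f0; apply: mfpsP => N; pose d := (mdeg N).+1.
transitivity (((1 - f) * \sum_(k < d) f ^+ k) N).
  rewrite !mfcoefM; apply: eq_bigr => k _; congr (_ * _).
  rewrite (@mfps_substE _ _ d) ?mfcoef_sum //; first last.
    by apply: bm_lt.
  by apply: eq_bigr => i _; rewrite mul1r.
by rewrite -opprB mulNr -subrX1 opprB mfcoefB mfcoef_exp_gt ?subr0.
Qed.

Fact mfps_mulVf : {in mfps_unit, left_inverse 1 mfps_inv *%R}.
Proof.
move=> f uf; rewrite /mfps_inv ifT //=.
have f0 : f 0%MM != 0 by [].
rewrite mulrAC -{1}[mfpsC _ * f](subKr 1) mfps_geometric //.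
by rewrite mfcoefB mfcoef1 mfcoefM0 /= eqxx mulr1 mulVf ?subrr.
Qed.

Fact mfps_intro_unit f g : g * f = 1 -> mfps_unit f.
Proof.
move=> /(congr1 (fun h : mfps K n => h 0%MM)); rewrite mfcoefM0 mfcoef1 eqxx.
rewrite /mfps_unit => gf1; apply: contra_eq_neq gf1 => ->.
by rewrite mulr0 eq_sym oner_neq0.
Qed.

Fact mfps_inv_out : {in [predC mfps_unit], mfps_inv =1 id}.
Proof. by move=> f /negbTE nuf; rewrite /mfps_inv ifF. Qed.

HB.instance Definition _ := GRing.ComNzRing_hasMulInverse.Build (mfps K n)
  mfps_mulVf mfps_intro_unit mfps_inv_out.

End PowerSeriesRing.

Section Definitions.
Variables (K : fieldType) (n : nat).

(* a (a - 1) ... (a - b + 1) / b!, meant for K of characteristic 0. *)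
Definition gbinom (a : K) (b : nat) : K :=
  (\prod_(i < b) (a - i%:R)) / (b`!)%:R.

(* The binomial series \sum_k binom(a, k) (f - 1)^k, meant for f with constant
   term 1. *)
Definition mfps_pow (f : mfps K n) (a : K) : mfps K n :=
  mfps_subst (gbinom a) (f - 1).

Definition is_solution (D G : 'M[K]_n) (Q : 'I_n -> mfps K n) : Prop :=
  (forall i, Q i 0%MM = 1) /\
  (forall i, \prod_j mfps_pow (Q j) (D i j)
             + mfpsX K i * \prod_j mfps_pow (Q j) (G i j) = 1).

Definition Qpow (Q : 'I_n -> mfps K n) (nu : 'rV[K]_n) : mfps K n :=
  \prod_i mfps_pow (Q i) (nu 0 i).

Variables (D G : 'M[K]_n) (nu : 'rV[K]_n).

Definition supp (N : 'X_{1..n}) : {set 'I_n} := [set i | N i != 0%N].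

Definition Pcoef (N : 'X_{1..n}) (i : 'I_n) : K :=
  - (\sum_j nu 0 j * invmx D j i)
  - \sum_j (N j)%:R * (G *m invmx D) j i.

Definition Fcoef (N : 'X_{1..n}) (i j : 'I_n) : K :=
  (i == j)%:R * Pcoef N j + (G *m invmx D) i j * (N j)%:R.

Definition detF (N : 'X_{1..n}) : K :=
  \det (\matrix_(i < #|supp N|, j < #|supp N|)
          Fcoef N (enum_val i) (enum_val j)).

Definition Kseries : mfps K n := MFPS (fun N =>
  \prod_(i in supp N) gbinom (Pcoef N i + (N i)%:R) (N i)).

Definition Rseries : mfps K n := MFPS (fun N =>
  detF N *
  \prod_(i in supp N)
     ((N i)%:R^-1 * gbinom (Pcoef N i + (N i)%:R - 1) (N i).-1)).

Lemma Kseries_unit : Kseries \is a GRing.unit.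
Proof.
rewrite unfold_in /= /mfps_unit /= big1 ?oner_neq0 // => i.
by rewrite inE mnm0E eqxx.
Qed.

End Definitions.

(* Main.v *)
Require Import Defs.
From mathcomp Require Import all_boot all_order all_algebra.
From mathcomp Require Import boolp reals complex mpoly ring.
Set Implicit Arguments.
Unset Strict Implicit.
Unset Printing Implicit Defensive.
Import GRing.Theory Num.Theory.
Local Open Scope ring_scope.

(** The proof views each of the three series as a function of the exponent
    vector [nu] and shows that all of them solve one linear system of difference
    equations, whose solutions are determined by their value at [nu = 0].

    Multiplying the [i]-th defining equation of [Q] by [Q^nu] gives
    [Q^(nu + D_i) = Q^nu - w_i Q^(nu + G_i)], where [D_i] and [G_i] are the rows
    of [D] and [G] ([shift_system_Qpow]).  For an arbitrary family [F] of series
    whose coefficients are polynomial in [nu], this system fixes [F] once [F 0]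
    is known: by induction on the degree in [w], the difference of two solutions
    with the same value at [0] has a coefficient which is a polynomial function
    of [nu], invariant under the translations by the rows of the invertible
    matrix [D], hence constant, hence zero ([shift_system_unique]).

    The series [R] and [K] solve the same system for a simple reason.  Replacing
    [nu] by [nu + D_i] lowers [P_i] by one and leaves the other [P_j] alone, and
    replacing [(nu, w^N)] by [(nu + G_i, w^(N - e_i))] does not change [P] at
    all.  Thus in terms of [P] the system says that lowering [P_i] by one
    multiplies the generating function over [N] at fixed [P] by [1 - z_i].
    The coefficient of [w^N] in [K] or in [R] is the determinant of an
    [n x n] matrix whose [j]-th column depends on [P_j] and [N_j] only, being
    the coefficient of [z^(N_j)] in [(1 - z)^(- P_j)] times a vector of series
    in [z]; so the system follows from the column linearity of the determinant
    and Pascal's rule ([shift_system_det_series]).  The determinant of [R] in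
    the statement runs over the support of [N]; the columns outside the support
    are unit vectors, so it equals the full one ([RseriesE]).

    At [nu = 0] the row vector [N] lies in the left kernel of the matrix of [R],
    whence [R^0 = 1 = Q^0] and so [Q^nu = R^nu]; and [K^nu], [K^0 R^nu] agree at
    [nu = 0], hence everywhere.  For the same reason [R^(mu + nu)] and
    [R^mu R^nu], as functions of [nu], are equal; a multiplicative family with
    polynomial coefficients is a product of powers, which gives the existence of
    a solution, namely [Q_i = R^(e_i)].  Its uniqueness follows from
    [Q_i = Q^(e_i) = R^(e_i)]. *)

(** * Polynomial functions and binomial coefficients *)

Section PolynomialFunctions.
Context {K : numFieldType}.
Implicit Types (f g : K -> K) (a : K).

Definition polyfun f := exists p : {poly K}, forall t, f t = p.[t].

Lemma eq_polyfun f g : f =1 g -> polyfun f -> polyfun g.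
Proof. by move=> fg [p fp]; exists p => t; rewrite -fg. Qed.

Lemma polyfunC a : polyfun (fun=> a).
Proof. by exists a%:P => t; rewrite hornerC. Qed.

Lemma polyfun_id : polyfun id.
Proof. by exists 'X => t; rewrite hornerX. Qed.

Lemma polyfunD f g : polyfun f -> polyfun g -> polyfun (fun t => f t + g t).
Proof. by move=> [p fp] [q gq]; exists (p + q) => t; rewrite hornerD fp gq. Qed.

Lemma polyfunM f g : polyfun f -> polyfun g -> polyfun (fun t => f t * g t).
Proof. by move=> [p fp] [q gq]; exists (p * q) => t; rewrite hornerM fp gq. Qed.

Lemma polyfunN f : polyfun f -> polyfun (fun t => - f t).
Proof. by move=> [p fp]; exists (- p) => t; rewrite hornerN fp. Qed.

Lemma polyfunB f g : polyfun f -> polyfun g -> polyfun (fun t => f t - g t).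
Proof. by move=> pf pg; apply/polyfunD/polyfunN. Qed.

Lemma polyfun_sum I (r : seq I) (P : pred I) (F : I -> K -> K) :
  (forall i, polyfun (F i)) -> polyfun (fun t => \sum_(i <- r | P i) F i t).
Proof.
move=> pF; elim: r => [|i r IHr].
  by apply: eq_polyfun (polyfunC 0) => t; rewrite big_nil.
apply: (@eq_polyfun (fun t => (if P i then F i t else 0)
                              + \sum_(j <- r | P j) F j t)).
  by move=> t; rewrite big_cons; case: ifP; rewrite ?add0r.
by apply: polyfunD IHr; case: (P i); [apply: pF | apply: polyfunC].
Qed.

Lemma polyfun_prod I (r : seq I) (P : pred I) (F : I -> K -> K) :
  (forall i, polyfun (F i)) -> polyfun (fun t => \prod_(i <- r | P i) F i t).
Proof.
move=> pF; elim: r => [|i r IHr].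
  by apply: eq_polyfun (polyfunC 1) => t; rewrite big_nil.
apply: (@eq_polyfun (fun t => (if P i then F i t else 1)
                              * \prod_(j <- r | P j) F j t)).
  by move=> t; rewrite big_cons; case: ifP; rewrite ?mul1r.
by apply: polyfunM IHr; case: (P i); [apply: pF | apply: polyfunC].
Qed.

Lemma polyfun_det m (M : K -> 'M[K]_m) :
  (forall i j, polyfun (fun t => M t i j)) -> polyfun (fun t => \det (M t)).
Proof.
move=> pM; rewrite /determinant; apply: polyfun_sum => s.
by apply: polyfunM; [apply: polyfunC | apply: polyfun_prod].
Qed.

Lemma polyfun_gbinom f k : polyfun f -> polyfun (fun t => gbinom (f t) k).
Proof.
move=> pf; apply: polyfunM (polyfunC _); apply: polyfun_prod => i.
exact: polyfunB pf (polyfunC _).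
Qed.

(** A polynomial taking the same value at all natural numbers is constant, as
    there are infinitely many of them in characteristic zero. *)
Lemma polyfun_periodic f :
  polyfun f -> (forall t, f (t + 1) = f t) -> forall t, f t = f 0.
Proof.
move=> [p fp] per t.
have fnat k : f k%:R = f 0.
  by elim: k => [|k IHk] //; rewrite -natr1 per.
pose q := p - (f 0)%:P.
suff q0 : q = 0.
  apply/eqP; rewrite -subr_eq0 [f t]fp; apply/eqP.
  by have := congr1 (fun r => r.[t]) q0; rewrite hornerD hornerN hornerC horner0.
apply/eqP/negPn/negP => q_neq0.
pose s : seq K := [seq k%:R | k <- iota 0 (size q)].
suff: (size s < size q)%N by rewrite size_map size_iota ltnn.
apply: max_poly_roots => //.
  apply/allP => x /mapP[k _ ->].
  by rewrite rootE hornerD hornerN hornerC -fp fnat subrr.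
by rewrite map_inj_uniq ?iota_uniq // => i j /eqP; rewrite eqr_nat => /eqP.
Qed.

Lemma gbinom0r a : gbinom a 0 = 1.
Proof. by rewrite /gbinom big_ord0 fact0 divr1. Qed.

Lemma mulSgbinom a k : k.+1%:R * gbinom a k.+1 = (a - k%:R) * gbinom a k.
Proof.
rewrite /gbinom big_ord_recr /= factS natrM.
have fk_neq0 : k`!%:R != 0 :> K by rewrite pnatr_eq0 -lt0n fact_gt0.
have k1_neq0 : 1 + k%:R != 0 :> K by rewrite nat1r pnatr_eq0.
by rewrite -nat1r; field; rewrite ?fk_neq0 ?k1_neq0.
Qed.

Lemma gbinom_succ a k : gbinom (a + 1) k.+1 = gbinom a k.+1 + gbinom a k.
Proof.
rewrite /gbinom big_ord_recl [in RHS]big_ord_recr /= subr0.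
under eq_bigr => i _ do rewrite /bump /= -natr1 opprD addrACA subrr addr0.
rewrite factS natrM.
have fk_neq0 : k`!%:R != 0 :> K by rewrite pnatr_eq0 -lt0n fact_gt0.
have k1_neq0 : 1 + k%:R != 0 :> K by rewrite nat1r pnatr_eq0.
by rewrite -nat1r; field; rewrite ?fk_neq0 ?k1_neq0.
Qed.

End PolynomialFunctions.

(** * Families of series with polynomial coefficients; powers of a series *)

Section SeriesFamilies.
Context {K : numFieldType} {n : nat}.
Implicit Types (F E : K -> mfps K n) (f g : mfps K n) (a b t : K).

Definition polyseries F := forall N, polyfun (fun t => F t N).

Lemma eq_polyseries F E : F =1 E -> polyseries F -> polyseries E.
Proof. by move=> FE pF N; apply: eq_polyfun (pF N) => t; rewrite FE. Qed.

Lemma polyseriesC f : polyseries (fun=> f).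
Proof. by move=> N; exact: polyfunC (f N). Qed.

Lemma polyseriesM F E :
  polyseries F -> polyseries E -> polyseries (fun t => F t * E t).
Proof.
move=> pF pE N.
apply: (@polyfun_sum _ _ _ _
  (fun (k : 'X_{1..n < _, _}) t => F t k.1 * E t k.2)) => k.
exact: polyfunM (pF _) (pE _).
Qed.

Lemma polyseries_prod I (r : seq I) (F : I -> K -> mfps K n) :
  (forall i, polyseries (F i)) -> polyseries (fun t => \prod_(i <- r) F i t).
Proof.
move=> pF; elim: r => [|i r IHr].
  by apply: eq_polyseries (polyseriesC 1) => t; rewrite big_nil.
apply: (@eq_polyseries (fun t => F i t * \prod_(j <- r) F j t)).
  by move=> t; rewrite big_cons.
exact: polyseriesM.
Qed.

Lemma polyseries_periodic F :
  polyseries F -> (forall t, F (t + 1) = F t) -> forall t, F t = F 0.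
Proof.
move=> pF per t; apply: mfpsP => N.
by rewrite (polyfun_periodic (pF N)) // => s; rewrite per.
Qed.

Lemma polyseries_pow f (l : K -> K) :
  polyfun l -> polyseries (fun t => mfps_pow f (l t)).
Proof.
move=> pl N; apply: polyfun_sum => k.
exact: polyfunM (polyfun_gbinom _ pl) (polyfunC _).
Qed.

Lemma mfpow0 f : mfps_pow f 0 = 1.
Proof.
apply: mfpsP => N; rewrite /= big_ord_recl gbinom0r mul1r expr0 big1 ?addr0 //.
by move=> k _; rewrite /gbinom /= big_ord_recl /= subrr !mul0r.
Qed.

Lemma mulr_subst (c : nat -> K) g : g 0%MM = 0 ->
  g * mfps_subst c g = mfps_subst (fun k => if k is k'.+1 then c k' else 0) g.
Proof.
move=> g0; apply: mfpsP => N; set d := (mdeg N).+1.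
transitivity (\sum_(k < d) c k * (g ^+ k.+1) N).
  rewrite mfcoefM; under eq_bigr => k _.
    rewrite (@mfps_substE _ _ _ _ d) ?bm_lt // mulr_sumr.
    under eq_bigr => i _ do rewrite mulrCA.
    over.
  rewrite exchange_big; apply: eq_bigr => i _.
  by rewrite -mulr_sumr exprS mfcoefM.
rewrite (@mfps_substE _ _ _ _ d.+1) // ?(leqW (leqnn _)) //.
by rewrite [RHS]big_ord_recl mul0r add0r.
Qed.

Lemma mfpow_succ f a : f 0%MM = 1 -> mfps_pow f (a + 1) = f * mfps_pow f a.
Proof.
move=> f1; have g0 : (f - 1) 0%MM = 0 by rewrite mfcoefB f1 mfcoef1 eqxx subrr.
rewrite -{2}(subrK 1 f) addrC mulrDl mul1r /mfps_pow mulr_subst //.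
apply: mfpsP => N; rewrite mfcoefD /= -big_split /=.
apply: eq_bigr => -[[|k] ltk] _ /=.
  by rewrite !gbinom0r mul0r add0r.
by rewrite addrC gbinom_succ addrC mulrDl.
Qed.

Lemma mfpow1 f : f 0%MM = 1 -> mfps_pow f 1 = f.
Proof. by move=> f1; rewrite -[1]add0r mfpow_succ // mfpow0 mulr1. Qed.

(** The series [f^(c + t) f^(- t)] is polynomial in [t] and invariant under
    [t -> t + 1] by Pascal's rule, so that it equals its value at [t = 0]. *)
Lemma mfpowD f a b : f 0%MM = 1 ->
  mfps_pow f (a + b) = mfps_pow f a * mfps_pow f b.
Proof.
move=> f1.
have cancel c t : mfps_pow f (c + t) * mfps_pow f (- t) = mfps_pow f c.
  rewrite (@polyseries_periodic (fun t => mfps_pow f (c + t) * mfps_pow f (- t))).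
  - by rewrite addr0 oppr0 mfpow0 mulr1.
  - apply: polyseriesM; apply: polyseries_pow.
      exact: polyfunD (polyfunC _) polyfun_id.
    exact: polyfunN polyfun_id.
  move=> s; rewrite addrA mfpow_succ // mulrAC -mfpow_succ //.
  by rewrite opprD subrK mulrC.
have inv_b : mfps_pow f (- b) * mfps_pow f b = 1.
  by rewrite mulrC -{1}[b]add0r cancel mfpow0.
by rewrite -[in RHS](cancel a b) -mulrA inv_b mulr1.
Qed.

(** By the same periodicity, [E t * (E 1)^(- t)] does not depend on [t]. *)
Lemma exponential_pow E : polyseries E -> E 0 = 1 ->
  (forall a b, E (a + b) = E a * E b) -> E 1 0%MM = 1 ->
  forall t, E t = mfps_pow (E 1) t.
Proof.
move=> pE E0 ED E11 t.
have cancel s : E s * mfps_pow (E 1) (- s) = 1.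
  rewrite (@polyseries_periodic (fun s => E s * mfps_pow (E 1) (- s))).
  - by rewrite E0 oppr0 mfpow0 mulr1.
  - apply: polyseriesM => //; apply: polyseries_pow.
    exact: polyfunN polyfun_id.
  by move=> u; rewrite ED -mulrA -mfpow_succ // opprD subrK.
rewrite -[LHS]mulr1 -(mfpow0 (E 1)) -(subrr t) mfpowD //.
by rewrite mulrCA cancel mulr1.
Qed.

End SeriesFamilies.

(** * The system of difference equations *)

Lemma mfcoefXM {K : fieldType} n i (f : mfps K n) N :
  (mfpsX K i * f) N = if N i == 0%N then 0 else f (N - U_(i))%MM.
Proof.
case: eqP => [Ni0|/eqP Ni].
  rewrite mfcoefM big1 // => -[k1 k2] /= /eqP eN.
  have [ek|_] := eqVneq (k1 : 'X_{1..n}) U_(i)%MM; last by rewrite mul0r.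
  have := congr1 (fun M : 'X_{1..n} => M i) eN.
  by rewrite Ni0 ek mnmDE mnm1E eqxx.
have leUN : (U_(i) <= N)%MM by rewrite lep1mP.
set d := (mdeg N).+1.
rewrite [LHS](@mfps_mul_trunc _ _ d _ _ 'X_[U_(i)] (mftrunc d f)) //.
- rewrite mulrC -{1}(submK leUN) addmC mcoeffMX mftruncE // ltnS.
  exact: mdegB.
- by move=> M _; rewrite mcoeffX eq_sym.
by move=> M ltM; rewrite mftruncE.
Qed.

Section ShiftSystem.
Context {K : numFieldType} {n : nat}.
Variables (D G : 'M[K]_n).
Hypothesis detD : \det D != 0.
Implicit Types (F E : 'rV[K]_n -> mfps K n) (nu : 'rV[K]_n).

(** Polynomial dependence on [nu] is tested on lines, which reduces it to
    polynomials in one variable; the periodicity argument moves along lines. *)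
Definition line_polynomial F :=
  forall nu a, polyseries (fun t => F (nu + t *: a)).

Definition shift_system F := forall nu i,
  F (nu + row i D) = F nu - mfpsX K i * F (nu + row i G).

Lemma sum_rows nu : nu = \sum_i (nu *m invmx D) 0 i *: row i D.
Proof.
rewrite -mulmx_sum_row mulmxKV //.
by rewrite unitmxE unitfE.
Qed.

(** The rows of [D] span the space, so [nu] is reached from [0] by moving along
    one row at a time, on lines where the coefficient is a periodic polynomial,
    hence constant. *)
Lemma line_polynomial_periodic F N : line_polynomial F ->
  (forall nu i, F (nu + row i D) N = F nu N) -> forall nu, F nu N = F 0 N.
Proof.
move=> pF per nu; rewrite [nu]sum_rows.
elim/big_rec: _ => [|i mu _ <-] //.
set c := (nu *m _) 0 i; rewrite addrC.
rewrite (polyfun_periodic (pF mu (row i D) N)) ?scale0r ?addr0 // => t.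
by rewrite scalerDl scale1r addrA per.
Qed.

(** In the system, the coefficients of degree [d] of [mfpsX K i * _] only
    involve coefficients of degree [d - 1].  If the latter agree for [F] and
    [E], then [F - E] has in degree [d] coefficients that are periodic along the
    rows of [D], thus constant in [nu] and equal to their value at [0]. *)
Lemma shift_system_unique F E : line_polynomial F -> line_polynomial E ->
  shift_system F -> shift_system E -> F 0 = E 0 -> F =1 E.
Proof.
move=> pF pE sF sE FE0 nu; apply: mfpsP => N.
have [d] := ubnP (mdeg N); elim: d => // d IHd in N nu *; rewrite ltnS => leN.
apply/eqP; rewrite -subr_eq0 -!mfcoefB; apply/eqP.
rewrite (@line_polynomial_periodic (fun mu => F mu - E mu)) ?FE0 ?subrr //.
- exact: mfcoef0.
- move=> mu a M; exact: (polyfunB (pF _ _ _) (pE _ _ _)).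
move=> mu i; rewrite sF sE !(mfcoefB, mfcoefXM).
case: eqP => [_|/eqP Ni]; first by rewrite !subr0.
rewrite (IHd (N - U_(i))%MM); last first.
  have leUN : (U_(i) <= N)%MM by rewrite lep1mP.
  by apply: leq_trans leN; rewrite -[in leqRHS](submK leUN) mdegD mdeg1 addn1.
by ring.
Qed.

Lemma shift_systemM F f :
  shift_system F -> shift_system (fun nu => f * F nu).
Proof. by move=> sF nu i; rewrite sF mulrBr mulrCA. Qed.

Lemma line_polynomialM F f :
  line_polynomial F -> line_polynomial (fun nu => f * F nu).
Proof. by move=> pF nu a; apply: polyseriesM (polyseriesC _) (pF _ _). Qed.

Lemma shift_systemD F mu :
  shift_system F -> shift_system (fun nu => F (mu + nu)).
Proof. by move=> sF nu i; rewrite !addrA sF. Qed.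

Lemma line_polynomialD F mu :
  line_polynomial F -> line_polynomial (fun nu => F (mu + nu)).
Proof.
move=> pF nu a; apply: eq_polyseries (pF (mu + nu) a) => t.
by rewrite addrA.
Qed.

End ShiftSystem.

(** * Products of powers *)

Section PowerProducts.
Context {K : numFieldType} {n : nat}.
Implicit Types (Q : 'I_n -> mfps K n) (nu mu : 'rV[K]_n).

Lemma Qpow0 Q : Qpow Q 0 = 1.
Proof. by rewrite /Qpow big1 // => i _; rewrite mxE mfpow0. Qed.

Lemma Qpow_delta Q i : (forall j, Q j 0%MM = 1) -> Qpow Q 'e_i = Q i.
Proof.
move=> Q1; rewrite /Qpow (bigD1 i) //= mxE !eqxx mfpow1 // big1 ?mulr1 // => j.
by move=> /negbTE ji; rewrite mxE eqxx ji mfpow0.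
Qed.

Lemma QpowD Q nu mu : (forall j, Q j 0%MM = 1) ->
  Qpow Q (nu + mu) = Qpow Q nu * Qpow Q mu.
Proof.
by move=> Q1; rewrite -big_split; apply: eq_bigr => j _; rewrite mxE mfpowD.
Qed.

Lemma line_polynomial_Qpow Q : line_polynomial (Qpow Q).
Proof.
move=> nu a; apply: polyseries_prod => i; apply: polyseries_pow.
apply: (@eq_polyfun _ (fun t => nu 0 i + t * a 0 i)) => [t|].
  by rewrite !mxE.
exact: polyfunD (polyfunC _) (polyfunM polyfun_id (polyfunC _)).
Qed.

Lemma Qpow_row Q (M : 'M[K]_n) i :
  Qpow Q (row i M) = \prod_j mfps_pow (Q j) (M i j).
Proof. by apply: eq_bigr => j _; rewrite mxE. Qed.

Lemma shift_system_Qpow D G Q :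
  is_solution D G Q -> shift_system D G (Qpow Q).
Proof.
move=> [Q1 eqQ] nu i; rewrite !QpowD // mulrCA !Qpow_row.
have /eqP := eqQ i; rewrite eq_sym -subr_eq => /eqP <-.
by rewrite mulrBr mulr1.
Qed.

Lemma is_solution_Qpow D G Q : (forall i, Q i 0%MM = 1) ->
  shift_system D G (Qpow Q) -> is_solution D G Q.
Proof.
move=> Q1 sQ; split=> // i; rewrite -!Qpow_row.
by have := sQ 0 i; rewrite !add0r Qpow0 => ->; rewrite subrK.
Qed.

Lemma exponential_Qpow (E : 'rV[K]_n -> mfps K n) : line_polynomial E ->
  E 0 = 1 -> {morph E : nu mu / nu + mu >-> nu * mu} ->
  (forall nu, E nu 0%MM = 1) -> E =1 Qpow (fun i => E 'e_i).
Proof.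
move=> pE E0 ED E1 nu; rewrite {1}[nu]row_sum_delta (big_morph E ED E0).
apply: eq_bigr => i _.
have -> : E 'e_i = E (1 *: 'e_i) by rewrite scale1r.
rewrite (exponential_pow (E := fun t => E (t *: 'e_i))) ?scale0r //.
  by apply: eq_polyseries (pE 0 'e_i) => t; rewrite add0r.
by move=> a b; rewrite scalerDl ED.
Qed.

End PowerProducts.

(** * Determinants *)

Section ColumnDeterminants.
Context {K : fieldType} {n : nat}.
Implicit Types (A B C M : 'M[K]_n).

Lemma det_colB A B C j :
  (forall k, A k j = B k j - C k j) ->
  (forall k l, l != j -> B k l = A k l /\ C k l = A k l) ->
  \det A = \det B - \det C.
Proof.
move=> colj off; rewrite -[in LHS]det_tr -[\det B]det_tr -[\det C]det_tr.
have off' k l : B k (lift j l) = A k (lift j l) /\ C k (lift j l) = A k (lift j l).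
  by apply: off; rewrite eq_sym neq_lift.
rewrite (@determinant_multilinear _ _ A^T B^T C^T j 1 (-1)).
- by rewrite mul1r mulN1r.
- by apply/rowP => k; rewrite !mxE colj mul1r mulN1r.
- by apply/matrixP => l k; rewrite !mxE; have [] := off' k l.
by apply/matrixP => l k; rewrite !mxE; have [] := off' k l.
Qed.

(** Sylvester's identity: both sides are the determinant of the block matrix
    with diagonal blocks [1] and off-diagonal blocks [- X] and [Y], which can be
    made triangular in two ways. *)
Lemma det_1mulmxC m (X : 'M[K]_(n, m)) (Y : 'M[K]_(m, n)) :
  \det (1%:M + X *m Y) = \det (1%:M + Y *m X).
Proof.
transitivity (\det (block_mx 1%:M (- X) Y 1%:M)).
  have -> : block_mx 1%:M (- X) Y 1%:M =
      block_mx (1%:M + X *m Y) (- X) 0 1%:M *m block_mx 1%:M 0 Y 1%:M.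
    rewrite mulmx_block !(mul0mx, mul1mx, mulmx1, mulmx0, add0r).
    by rewrite mulNmx addrK.
  by rewrite det_mulmx det_ublock det_lblock !det1 !mulr1.
have -> : block_mx 1%:M (- X) Y 1%:M =
    block_mx 1%:M 0 Y 1%:M *m block_mx 1%:M (- X) 0 (1%:M + Y *m X).
  rewrite mulmx_block !(mul0mx, mul1mx, mulmx1, mulmx0, addr0).
  by rewrite mulmxN addrC addrK.
by rewrite det_mulmx det_ublock det_lblock !det1 !mul1r.
Qed.

(** The matrix on the left is the identity plus a matrix that factors through
    the coordinates in [S], so Sylvester's identity moves its determinant to a
    matrix of size [#|S|]. *)
Lemma det_principal (S : {set 'I_n}) M :
  \det (\matrix_(i, j) if j \in S then M i j else (i == j)%:R) =
  \det (\matrix_(i < #|S|, j < #|S|) M (enum_val i) (enum_val j)).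
Proof.
pose X : 'M[K]_(n, #|S|) := \matrix_(i, s) (M - 1%:M) i (enum_val s).
pose Y : 'M[K]_(#|S|, n) := \matrix_(s, j) (enum_val s == j)%:R.
transitivity (\det (1%:M + X *m Y)).
  congr (\det _); apply/matrixP => i j; rewrite !mxE.
  under eq_bigr => s _ do rewrite !mxE.
  case: ifPn => [jS|jNS]; last first.
    rewrite big1 ?addr0 // => s _.
    have [ej|_] := eqVneq (enum_val s) j; last by rewrite mulr0.
    by rewrite -ej enum_valP in jNS.
  rewrite (bigD1 (enum_rank_in jS j)) //= enum_rankK_in // eqxx mulr1.
  rewrite big1 ?addr0 => [|s s_neq]; first by rewrite addrCA subrr addr0.
  have [ej|_] := eqVneq (enum_val s) j; last by rewrite mulr0.
  by rewrite -(enum_valK_in jS s) ej eqxx in s_neq.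
rewrite det_1mulmxC; congr (\det _); apply/matrixP => s t; rewrite !mxE.
rewrite (bigD1 (enum_val s)) //= big1 ?addr0 => [|k /negbTE ks].
  by rewrite !mxE eqxx mul1r (inj_eq enum_val_inj) addrCA subrr addr0.
by rewrite !mxE eq_sym ks mul0r.
Qed.

End ColumnDeterminants.

(** * The series K and R *)

Section DeterminantSeries.
Context {K : numFieldType} {n : nat}.
Variables (D G : 'M[K]_n).
Hypothesis detD : \det D != 0.
Implicit Types (nu : 'rV[K]_n) (N : 'X_{1..n}) (p : K) (m : nat).

Let unitD : D \in unitmx. Proof. by rewrite unitmxE unitfE. Qed.
Let A := G *m invmx D.

Definition expvec N : 'rV[K]_n := \row_k (N k)%:R.

Lemma PcoefE nu N j :
  Pcoef D G nu N j = - (nu *m invmx D) 0 j - (expvec N *m A) 0 j.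
Proof.
rewrite /Pcoef [(nu *m _) 0 j]mxE [(expvec N *m _) 0 j]mxE; congr (_ - _).
by apply: eq_bigr => k _; rewrite [expvec N 0 k]mxE.
Qed.

Lemma Pcoef_rowD nu N i j :
  Pcoef D G (nu + row i D) N j = Pcoef D G nu N j - (i == j)%:R.
Proof.
rewrite !PcoefE mulmxDl -row_mul mulmxV // [(_ + row i _) 0 j]mxE.
by rewrite [row i 1%:M 0 j]mxE [1%:M i j]mxE opprD addrAC.
Qed.

(** The exponent [G_i] contributes [- A_ij] to [P_j], where [A = G D^-1], which
    is compensated by lowering [N_i] by one. *)
Lemma Pcoef_rowG nu N i j : N i != 0%N ->
  Pcoef D G (nu + row i G) (N - U_(i))%MM j = Pcoef D G nu N j.
Proof.
move=> Ni; have leUN : (U_(i) <= N)%MM by rewrite lep1mP.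
have -> : Pcoef D G nu N j = Pcoef D G nu (N - U_(i) + U_(i))%MM j.
  by rewrite submK.
have expD M : expvec (M + U_(i))%MM = expvec M + 'e_i.
  by apply/rowP => k; rewrite !mxE mnmDE mnm1E natrD eq_sym.
rewrite !PcoefE expD !mulmxDl -row_mul -rowE -/A.
by rewrite [(_ + row i A) 0 j]mxE [X in _ = _ - X]mxE; ring.
Qed.

Lemma polyfun_Pcoef nu a N j : polyfun (fun t => Pcoef D G (nu + t *: a) N j).
Proof.
apply: (@eq_polyfun _ (fun t => Pcoef D G nu N j - t * (a *m invmx D) 0 j)).
  by move=> t; rewrite !PcoefE mulmxDl -scalemxAl [(nu *m _ + _) 0 j]mxE
    [(t *: (a *m _)) 0 j]mxE; ring.
exact: polyfunB (polyfunC _) (polyfunM polyfun_id (polyfunC _)).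
Qed.

(** The common shape of [K] and [R].  Each [c k j p] is meant to be the sequence
    of coefficients of a power series in one variable; as [P_j] and [N_j] enter
    column [j] only, changing one of them affects a single column. *)
Definition det_series (c : 'I_n -> 'I_n -> K -> nat -> K) nu : mfps K n :=
  MFPS (fun N => \det (\matrix_(k, j) c k j (Pcoef D G nu N j) (N j))).

Lemma line_polynomial_det_series c :
  (forall k j m, polyfun (fun p => c k j p m)) -> line_polynomial (det_series c).
Proof.
move=> pc nu a N; apply: polyfun_det => k j.
have [q cq] := pc k j (N j); have [r Pr] := polyfun_Pcoef nu a N j.
by exists (q \Po r) => t; rewrite mxE horner_comp -Pr cq.
Qed.

(** The hypotheses say that lowering [p] by one multiplies the generating
    series of [m -> c k j p m] by [1 - z].  Since the shifts only modify column
    [i], the linearity of the determinant in this column gives the system. *)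
Lemma shift_system_det_series c :
  (forall k j p m, c k j (p - 1) m.+1 = c k j p m.+1 - c k j p m) ->
  (forall k j p, c k j (p - 1) 0%N = c k j p 0%N) ->
  shift_system D G (det_series c).
Proof.
move=> cS c0 nu i; apply: mfpsP => N; rewrite mfcoefB mfcoefXM /=.
case: eqP => [Ni|/eqP Ni].
  rewrite subr0; congr (\det _); apply/matrixP => k j; rewrite !mxE Pcoef_rowD.
  by case: eqP => [<-|_]; rewrite ?subr0 // Ni c0.
apply: (det_colB (j := i)) => [k|k l /negbTE li]; rewrite !mxE !Pcoef_rowG //.
  rewrite Pcoef_rowD eqxx mnmBE mnm1E eqxx.
  by case: (N i) Ni => // m _; rewrite cS subn1.
by rewrite Pcoef_rowD mnmBE mnm1E [i == l]eq_sym li subn0 subr0.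
Qed.

(** The coefficient of [z^m] in [(1 - z)^(- p)]. *)
Definition negbinom p m := gbinom (p + m%:R - 1) m.

Lemma negbinom0 p : negbinom p 0 = 1.
Proof. exact: gbinom0r. Qed.

Lemma negbinom_pred p m :
  negbinom (p - 1) m.+1 = negbinom p m.+1 - negbinom p m.
Proof.
rewrite /negbinom; have -> : p + m.+1%:R - 1 = p + m%:R - 1 + 1.
  by rewrite -natr1; ring.
rewrite gbinom_succ addrK; congr (gbinom _ _).
by rewrite -natr1; ring.
Qed.

Lemma mulS_negbinom p m :
  m.+1%:R * negbinom p m.+1 = p * negbinom (p + 1) m.
Proof.
rewrite /negbinom mulSgbinom -natr1.
by congr (_ * gbinom _ _); ring.
Qed.

Lemma negbinom_add1 p m : negbinom (p + 1) m = gbinom (p + m%:R) m.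
Proof. by congr gbinom; ring. Qed.

Lemma polyfun_negbinom f m :
  polyfun f -> polyfun (fun t : K => negbinom (f t) m).
Proof.
move=> pf; apply: polyfun_gbinom.
exact: polyfunB (polyfunD pf (polyfunC _)) (polyfunC _).
Qed.

(** The product of the [binom(P_j + N_j, N_j)], which are the coefficients of
    [(1 - z)^(- P_j - 1)], is put in the form of a diagonal determinant in order
    to treat [K] and [R] alike. *)
Definition Kentry (k j : 'I_n) p m := (k == j)%:R * negbinom (p + 1) m.

Lemma KseriesE nu : Kseries D G nu = det_series Kentry nu.
Proof.
apply: mfpsP => N /=.
pose d := \row_j negbinom (Pcoef D G nu N j + 1) (N j).
have -> : \matrix_(k, j) Kentry k j (Pcoef D G nu N j) (N j) = diag_mx d.
  apply/matrixP => k j; rewrite !mxE /Kentry.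
  by case: eqP => [->|_]; rewrite ?mul1r ?mul0r.
rewrite det_diag big_mkcond /=; apply: eq_bigr => j _.
rewrite inE mxE negbinom_add1.
by case: (N j) => //=; rewrite gbinom0r.
Qed.

Lemma shift_system_Kseries : shift_system D G (Kseries D G).
Proof.
have s : shift_system D G (det_series Kentry).
  apply: shift_system_det_series => k j p *; rewrite /Kentry.
    by rewrite -mulrBr -{1}(addrK 1 p) addrAC negbinom_pred addrK.
  by rewrite !negbinom0.
by move=> nu i; rewrite !KseriesE s.
Qed.

Lemma line_polynomial_Kseries : line_polynomial (Kseries D G).
Proof.
move=> nu a; apply: (@eq_polyseries _ _
  (fun t => det_series Kentry (nu + t *: a))).
  by move=> t; rewrite KseriesE.
apply: line_polynomial_det_series => k j m.
apply: polyfunM (polyfunC _) _; apply: polyfun_negbinom.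
exact: polyfunD polyfun_id (polyfunC _).
Qed.

(** The coefficients in [z] of [(1 - z)^(- p) (delta_kj + A_kj z / (1 - z))].
    The determinant of the second factors, with [z = z_j] in column [j], is the
    Jacobian that occurs in the multivariate Lagrange inversion formula. *)
Definition Rentry (k j : 'I_n) p m :=
  (k == j)%:R * negbinom p m
  + A k j * (if m is m'.+1 then negbinom (p + 1) m' else 0).

(** Column [j] is a unit vector if [N_j = 0], and otherwise it is column [j] of
    [F] times the [j]-th factor of the product in [R], because
    [m binom(p + m - 1, m) = p binom(p + m - 1, m - 1)]. *)
Lemma RseriesE nu : Rseries D G nu = det_series Rentry nu.
Proof.
apply: mfpsP => N /=; set S := supp N.
pose P := Pcoef D G nu N; pose F := Fcoef D G nu N.
pose d := \row_j (if j \in S then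
  (N j)%:R^-1 * gbinom (P j + (N j)%:R - 1) (N j).-1 else 1).
have -> : \matrix_(k, j) Rentry k j (P j) (N j) =
    (\matrix_(i, j) if j \in S then (\matrix_(i, j) F i j) i j
                     else (i == j)%:R) *m diag_mx d.
  rewrite mul_mx_diag; apply/matrixP => k j; rewrite !mxE /Rentry inE.
  case Nj: (N j) => [|m] /=.
    by rewrite negbinom0 mulr0 addr0.
  have m1 : m.+1%:R != 0 :> K by rewrite pnatr_eq0.
  have -> : P j + m.+1%:R - 1 = P j + m%:R by rewrite -natr1 addrA addrK.
  rewrite -negbinom_add1; apply: (mulfI m1).
  rewrite [RHS]mulrCA mulVKf // mulrDr mulrCA mulS_negbinom.
  by rewrite /F /Fcoef -/(P j) Nj -/A; ring.
rewrite det_mulmx det_diag det_principal; congr (_ * _).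
  by congr (\det _); apply/matrixP => i j; rewrite !mxE.
by rewrite big_mkcond; apply: eq_bigr => j _; rewrite mxE.
Qed.

Lemma shift_system_Rseries : shift_system D G (Rseries D G).
Proof.
have s : shift_system D G (det_series Rentry).
  apply: shift_system_det_series => k j p; last by rewrite /Rentry !negbinom0.
  case=> [|m]; rewrite /Rentry negbinom_pred ?negbinom0; first by ring.
  have -> : p - 1 + 1 = p + 1 - 1 by ring.
  by rewrite negbinom_pred; ring.
by move=> nu i; rewrite !RseriesE s.
Qed.

Lemma line_polynomial_Rseries : line_polynomial (Rseries D G).
Proof.
move=> nu a; apply: (@eq_polyseries _ _
  (fun t => det_series Rentry (nu + t *: a))).
  by move=> t; rewrite RseriesE.
apply: line_polynomial_det_series => k j m.
apply: polyfunD; apply: polyfunM (polyfunC _) _.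
  exact: polyfun_negbinom polyfun_id.
case: m => [|m]; first exact: polyfunC.
by apply: polyfun_negbinom; apply: polyfunD polyfun_id (polyfunC _).
Qed.

Lemma Rseries_const nu : Rseries D G nu 0%MM = 1.
Proof.
rewrite RseriesE /= -[RHS](det1 K n); congr (\det _); apply/matrixP => k j.
by rewrite !mxE /Rentry mnm0E negbinom0 mulr1 mulr0 addr0.
Qed.

(** At [nu = 0] one has [P_j = - \sum_k N_k A_kj], and the entries of the
    product of the row [N] with the matrix of [R] vanish one by one; a nonzero
    [N] thus makes the matrix singular. *)
Lemma Rseries0 : Rseries D G 0 = 1.
Proof.
apply: mfpsP => N; rewrite mfcoef1.
have [->|N_neq0] := eqVneq N 0%MM; first exact: Rseries_const.
rewrite RseriesE; apply/eqP/det0P; exists (expvec N).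
  apply: contra_neq N_neq0 => eN; apply/mnmP => k; rewrite mnm0E.
  by apply/eqP; rewrite -(pnatr_eq0 K); have /rowP/(_ k) := eN; rewrite !mxE => ->.
apply/rowP => j; rewrite !mxE.
under eq_bigr => k _ do rewrite !mxE mulrDr mulrA.
rewrite big_split /= (bigD1 j) //= eqxx mulr1 big1 ?addr0; last first.
  by move=> k /negbTE ->; rewrite mulr0 mul0r.
under eq_bigr => k _ do rewrite mulrA.
rewrite -mulr_suml.
have -> : \sum_k (N k)%:R * A k j = - Pcoef D G 0 N j.
  rewrite PcoefE mul0mx mxE oppr0 sub0r opprK [RHS]mxE.
  by apply: eq_bigr => k _; rewrite [expvec N 0 k]mxE.
case: (N j) => [|m]; first by rewrite mul0r mulr0 addr0.
by rewrite mulS_negbinom mulNr subrr.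
Qed.

End DeterminantSeries.

(** * Comparison of the solutions *)

Section Solution.
Context {K : numFieldType} {n : nat}.
Variables (D G : 'M[K]_n).
Hypothesis detD : \det D != 0.
Implicit Types (nu mu : 'rV[K]_n).

Lemma Qpow_Rseries Q nu : is_solution D G Q -> Qpow Q nu = Rseries D G nu.
Proof.
move=> solQ; apply: (shift_system_unique detD (G := G)).
- exact: line_polynomial_Qpow.
- exact: line_polynomial_Rseries.
- exact: shift_system_Qpow.
- exact: shift_system_Rseries.
by rewrite Qpow0 Rseries0.
Qed.

Lemma RseriesD : {morph Rseries D G : nu mu / nu + mu >-> nu * mu}.
Proof.
move=> nu mu.
apply: (shift_system_unique detD (G := G) (F := fun mu => Rseries D G (nu + mu))
                            (E := fun mu => Rseries D G nu * Rseries D G mu)).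
- exact: line_polynomialD (line_polynomial_Rseries _ _).
- exact: line_polynomialM (line_polynomial_Rseries _ _).
- exact: shift_systemD (shift_system_Rseries _ _).
- exact: shift_systemM (shift_system_Rseries _ _).
by rewrite addr0 Rseries0 // mulr1.
Qed.

(** The family [R^nu] is multiplicative in [nu], so it consists of the products
    of powers of the [R^(e_i)]; for these the difference system at [nu = 0] is
    the system of equations to be solved. *)
Lemma is_solution_Rseries : is_solution D G (fun i => Rseries D G 'e_i).
Proof.
have RQ : Rseries D G =1 Qpow (fun i => Rseries D G 'e_i).
  apply: exponential_Qpow.
  - exact: line_polynomial_Rseries.
  - exact: Rseries0.
  - exact: RseriesD.
  - exact: Rseries_const.
apply: is_solution_Qpow => [i|nu i]; first exact: Rseries_const.
by rewrite -!RQ shift_system_Rseries.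
Qed.

Lemma Kseries_Rseries nu : Kseries D G nu = Kseries D G 0 * Rseries D G nu.
Proof.
apply: (shift_system_unique detD (G := G)
                            (E := fun nu => Kseries D G 0 * Rseries D G nu)).
- exact: line_polynomial_Kseries.
- exact: line_polynomialM (line_polynomial_Rseries _ _).
- exact: shift_system_Kseries.
- exact: shift_systemM (shift_system_Rseries _ _).
by rewrite Rseries0 // mulr1.
Qed.

End Solution.

Theorem theorem2p4 (R : realType) (n : nat) (D G : 'M[R[i]]_n)
    (hD : \det D != 0) :
  (exists! Q : 'I_n -> mfps R[i] n, is_solution D G Q) /\
  (forall Q : 'I_n -> mfps R[i] n, is_solution D G Q ->
   forall nu : 'rV[R[i]]_n,
     Qpow Q nu = Kseries D G nu / Kseries D G 0 /\
     Qpow Q nu = Rseries D G nu).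
Proof.
split.
  exists (fun i => Rseries D G 'e_i); split; first exact: is_solution_Rseries.
  move=> Q solQ; apply/funext => i.
  by rewrite -(Qpow_Rseries hD _ solQ) Qpow_delta //; case: solQ.
move=> Q solQ nu; rewrite (Qpow_Rseries hD _ solQ); split=> //.
by rewrite (Kseries_Rseries _ hD) mulrC mulKr // Kseries_unit.
Qed.
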